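(* Let $\{\sigma_N\}_{N=1}^\infty$ be a sequence of non-empty finite subsets of $\mathbb{N}$ such that for some $n\in\mathbb{N}$ the convergence $$ \frac{\#\{k\in\sigma_N: nk\in\sigma_N\}}{\#\sigma_N}\to 1\quad\text{as } N\to\infty $$ fails. Then there exists a real-valued symbol $\varphi\in C(\mathbb{T}^\infty)$ such that, for $f(x)=x^2$, the relation $$ \lim_{N\to\infty}\frac{1}{\#\sigma_N}\operatorname{Tr} f(\mathbf{T}_{\sigma_N}(\varphi))=\int_{\mathbb{T}^\infty} f(\varphi(z))\,d\mathbf{m}(z) $$ fails (that is, the limit either does not exist or is not equal to the right-hand side). In fact, one can take $\varphi(z)=z^\alpha+z^{-\alpha}$, where $n=p^\alpha$.
   Context: $\mathbb{N}=\{1,2,\dots\}$, and $\#X$ is the cardinality of a finite set $X$. $\mathbb{T}$ is the unit circle in $\mathbb{C}$, and $\mathbb{T}^\infty$ is the product of countably many copies of $\mathbb{T}$ with the product topology, a compact abelian group with normalised Haar measure $\mathbf{m}$. $\mathbb{Z}^{(\infty)}$ is the set of integer sequences $\alpha=(\alpha_1,\alpha_2,\dots)$ with only finitely many non-zero entries; $z^\alpha=z_1^{\alpha_1}z_2^{\alpha_2}\cdots$ for $z\in\mathbb{T}^\infty$. Let $p_1<p_2<\dots$ be the primes; every positive rational $q$ is uniquely $q=p^\alpha:=p_1^{\alpha_1}p_2^{\alpha_2}\cdots$ with $\alpha\in\mathbb{Z}^{(\infty)}$. The Fourier coefficients of $\varphi\in L^2(\mathbb{T}^\infty)$ are labelled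 by positive rationals: $\widehat\varphi(p^\alpha)=\int_{\mathbb{T}^\infty}\varphi(z)\overline{z^\alpha}\,d\mathbf{m}(z)$. For a finite set $\sigma\subset\mathbb{N}$, $\mathbf{T}_\sigma(\varphi)$ is the matrix $\{\widehat\varphi(j/k)\}_{j,k\in\sigma}$. *)

(* Defs.v *)
From HB Require Import structures.
From mathcomp Require Export all_boot all_order all_algebra.
From mathcomp Require Export finmap complex.
From mathcomp Require Export all_classical all_reals all_analysis.

Set Implicit Arguments.
Unset Strict Implicit.
Unset Printing Implicit Defensive.

Export Order.TTheory GRing.Theory Num.Theory.
Export numFieldNormedType.Exports.

Local Open Scope classical_set_scope.
Local Open Scope ring_scope.
Local Open Scope complex_scope.

Lemma next_prime_ex (m : nat) : exists q : nat, (m < q)%N && prime q.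
Proof. by have [q mq pq] := prime_above m; exists q; rewrite mq. Qed.

Definition next_prime (m : nat) : nat := ex_minn (next_prime_ex m).

(* The increasing enumeration of the primes, indexed from 0: nth_prime 0 = 2. *)
Definition nth_prime (i : nat) : nat := iter i next_prime 2.

(* Finitely supported integer sequences, also indexed from 0, so that the
   i-th entry is the exponent of nth_prime i and of the coordinate z i. *)
Definition expseq := {fsfun nat -> int with 0}.

Definition opp_expseq (a : expseq) : expseq :=
  [fsfun i in finsupp a => - a i].

Definition prime_pow (a : expseq) : rat :=
  \prod_(i <- finsupp a) ((nth_prime i)%:R : rat) ^ a i.

(* The exponent sequence of q, characterised by prime_pow (exponents q) = q
   when q > 0; junk value for q <= 0. *)
Definition exponents (q : rat) : expseq :=
  xget [fsfun] [set a : expseq | prime_pow a = q].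

(* The library puts the norm topology on a numFieldType variable, but not on
   the concrete type R[i]. *)
HB.instance Definition _ (R : rcfType) := GRing.ComAlgebra.copy R[i] R[i]^o.
HB.instance Definition _ (R : rcfType) := Vector.copy R[i] R[i]^o.
HB.instance Definition _ (R : rcfType) := NormedModule.copy R[i] R[i]^o.

Section Torus.
Variable R : realType.

Definition circle := set_type [set z : R[i] | `|z| = 1].

HB.instance Definition _ := Topological.on circle.

Definition circle1 : circle :=
  exist _ (1 : R[i]) (mem_set (normr1 _)).

HB.instance Definition _ := isPointed.Build circle circle1.

Lemma circle_mul_subproof (u v : circle) :
  (val u * val v) \in [set z : R[i] | `|z| = 1].
Proof.
apply/mem_set; rewrite /= normrM.
by rewrite (set_mem (valP u)) (set_mem (valP v)) mulr1.
Qed.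

Definition circle_mul (u v : circle) : circle :=
  exist _ (val u * val v) (circle_mul_subproof u v).

Definition torus := prod_topology (fun _ : nat => circle).

HB.instance Definition _ := Topological.on torus.
HB.instance Definition _ := Pointed.on torus.

Definition torus_mul (w z : torus) : torus :=
  fun i => circle_mul (w i) (z i).

Definition borel_torus := g_sigma_algebraType (@open torus).

(* m being of type probability is the normalisation; on the compact metrisable
   group torus, regularity of Borel probability measures is automatic. *)
Definition is_haar (m : probability borel_torus R) : Prop :=
  forall (w : torus) (A : set borel_torus), measurable A ->
    m (torus_mul w @` A) = m A.

(* z ^ a *)
Definition monomial (a : expseq) (z : torus) : R[i] :=
  \prod_(i <- finsupp a) val (z i) ^ a i.

Section Toeplitz.
Variable m : probability borel_torus R.

Definition torus_integral (g : torus -> R[i]) : R[i] :=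
  (\int[m]_(z in setT) complex.Re (g z))%R +i* (\int[m]_(z in setT) complex.Im (g z))%R.

Definition fourier (phi : torus -> R[i]) (q : rat) : R[i] :=
  torus_integral (fun z => phi z * (monomial (exponents q) z)^*).

(* Rows and columns are listed in the enumeration order of s; another order
   conjugates the matrix by a permutation matrix. *)
Definition toeplitz (phi : torus -> R[i]) (s : {fset nat}) : 'M[R[i]]_#|` s| :=
  \matrix_(i, j) fourier phi ((nth 0%N s i)%:R / (nth 0%N s j)%:R).

(* The limit relation for f(x) = x ^ 2. *)
Definition square_trace_limit (sigma : nat -> {fset nat})
    (phi : torus -> R[i]) : Prop :=
  (#|` sigma N|%:R^-1 * \tr (toeplitz phi (sigma N) ^+ 2) : R[i])
     @[N --> \oo] --> torus_integral (fun z => phi z ^+ 2).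

End Toeplitz.

Definition real_symbol (phi : torus -> R[i]) : Prop :=
  continuous phi /\ forall z, phi z \is Num.real.

Definition cosine_symbol (a : expseq) (z : torus) : R[i] :=
  monomial a z + monomial (opp_expseq a) z.

End Torus.

Definition dilation_ratio (R : realType) (n : nat) (s : {fset nat}) : R :=
  #|` [fset k in s | (n * k)%N \in s]%fset|%:R / #|` s|%:R.

(* Main.v *)
(* Write phi = z ^ a + z ^ (- a), where n = p ^ a and a != 0.  Orthogonality of
   the characters gives int phi ^ 2 = 2 and shows that the (j, k) entry of the
   Toeplitz matrix is 1 if j = n k or k = n j, and 0 otherwise.  Hence the
   trace of its square is twice the number of k in sigma with n k in sigma, and
   the limit relation for phi says that the dilation ratio tends to 1. *)
Require Import Defs.
From mathcomp Require Import zify measurable_realfun.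

Local Open Scope classical_set_scope.
Local Open Scope ring_scope.
Local Open Scope complex_scope.

(** * Enumeration of the primes and uniqueness of prime factorisation *)

Lemma next_primeP m : (m < next_prime m)%N /\ prime (next_prime m).
Proof. by rewrite /next_prime; case: ex_minnP => q /andP[]. Qed.

Lemma next_prime_le m q : (m < q)%N -> prime q -> (next_prime m <= q)%N.
Proof.
by rewrite /next_prime => mq pq; case: ex_minnP => r _; apply; rewrite mq.
Qed.

Lemma nth_prime_prime i : prime (nth_prime i).
Proof. by case: i => // i; have [] := next_primeP (nth_prime i). Qed.

Lemma nth_prime_inj : injective nth_prime.
Proof.
apply: incn_inj; apply: leq_mono.
apply: (@homo_ltn _ nth_prime (fun k l => (k < l)%N)) => [l k q|i].
  exact: ltn_trans.
by have [] := next_primeP (nth_prime i).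
Qed.

Lemma nth_prime_gt i : (i < nth_prime i)%N.
Proof.
elim: i => // i /leq_ltn_trans; apply.
by have [] := next_primeP (nth_prime i).
Qed.

(** Since [nth_prime i] exceeds [i], there is a largest [i] with [nth_prime i <= p]. Were this
    inequality strict, the next prime would still be at most [p], against maximality. *)
Lemma nth_prime_surj p : prime p -> exists i, nth_prime i = p.
Proof.
move=> pp; pose P i := (nth_prime i <= p)%N.
have exP : exists i, P i by exists 0; exact: prime_gt1.
have ubP i : P i -> (i <= p)%N by apply: leq_trans; exact/ltnW/nth_prime_gt.
case: (ex_maxnP exP ubP) => i; rewrite /P.
rewrite leq_eqVlt => /predU1P[<- _|]; first by exists i.
by move=> /next_prime_le/(_ pp) ip /(_ i.+1 ip); rewrite ltnn.
Qed.

Lemma prod_nth_prime_gt0 (s : seq nat) (e : nat -> nat) :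
  (0 < \prod_(i <- s) nth_prime i ^ e i)%N.
Proof.
by rewrite prodn_cond_gt0 // => i _; rewrite expn_gt0 prime_gt0 ?nth_prime_prime.
Qed.

Lemma logn_prod_nth_prime (s : seq nat) (e : nat -> nat) j : uniq s ->
  logn (nth_prime j) (\prod_(i <- s) nth_prime i ^ e i) =
  if j \in s then e j else 0.
Proof.
elim: s => [|k s IHs] /=; first by rewrite big_nil logn1.
case/andP => ks us; rewrite big_cons lognM ?prod_nth_prime_gt0 ?IHs //; last first.
  by rewrite expn_gt0 prime_gt0 ?nth_prime_prime.
rewrite lognX logn_prime ?nth_prime_prime // (inj_eq nth_prime_inj) in_cons.
by case: eqVneq => [->|_]; rewrite ?(negPf ks) ?muln1 ?addn0 ?muln0.
Qed.

(** Entries outside the support contribute a factor one; two sequences can thus be compared over a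
    common index set. *)
Lemma prime_pow_fset (a : expseq) (S : {fset nat}) : (finsupp a `<=` S)%fset ->
  prime_pow a = \prod_(i <- S) ((nth_prime i)%:R : rat) ^ a i.
Proof.
move=> aS; apply: big_fset_incl => // i _; rewrite memNfinsupp => /eqP ->.
by rewrite expr0z.
Qed.

(* Multiplying by a common denominator turns the equation into one between
   natural numbers, where exponents can be read off by [logn]. *)
Lemma prime_pow_inj : injective prime_pow.
Proof.
move=> a b ab; apply/fsfunP => j.
have [jS|] := boolP (j \in finsupp a `|` finsupp b)%fset; last first.
  by rewrite inE negb_or !memNfinsupp => /andP[/eqP -> /eqP ->].
move: ab; set S := (_ `|` _)%fset in jS *.
rewrite (@prime_pow_fset a S) ?fsubsetUl // (@prime_pow_fset b S) ?fsubsetUr // => ab.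
(* Shifting by this single bound makes all exponents [a i + M] and [b i + M] with [i] in [S]
   nonnegative. *)
pose M := (\sum_(i <- S) (`|a i| + `|b i|))%N.
have ltM i : i \in S -> (`|a i| + `|b i| <= M)%N.
  by move=> iS; rewrite /M (big_rem i) //= leq_addr.
have common (c : nat -> int) : (forall i, i \in S -> 0 <= c i + M%:Z) ->
    (\prod_(i <- S) (nth_prime i)%:R ^ c i) *
    (\prod_(i <- S) (nth_prime i)%:R ^ M%:Z) =
    (\prod_(i <- S) nth_prime i ^ `|(c i + M%:Z)%R|)%N%:R :> rat.
  move=> c0; rewrite -big_split natr_prod /= big_seq [RHS]big_seq.
  apply: eq_bigr => i iS; rewrite natrX -expfzDr; last first.
    by rewrite pnatr_eq0 -lt0n prime_gt0 ?nth_prime_prime.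
  by rewrite -[X in _ ^ X]gez0_abs ?c0.
have /eqP := congr1 (fun x => x * \prod_(i <- S) (nth_prime i)%:R ^ M%:Z) ab.
rewrite !common; try by move=> i /ltM; lia.
rewrite eqr_nat => /eqP/(congr1 (logn (nth_prime j))).
rewrite !logn_prod_nth_prime ?fset_uniq // jS.
by have := ltM _ jS; lia.
Qed.

Lemma prime_pow_nat n : (0 < n)%N -> exists a : expseq, prime_pow a = n%:R.
Proof.
move=> n_gt0; pose S : {fset nat} := [fset i | i in iota 0 n]%fset.
pose a : expseq := [fsfun i in S => (logn (nth_prime i) n)%:Z].
have SE i : (i \in S) = (i < n)%N by rewrite !inE mem_iota.
exists a; rewrite (@prime_pow_fset a S); last exact: finsupp_sub.
transitivity ((\prod_(i <- S) nth_prime i ^ logn (nth_prime i) n)%N%:R : rat).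
  rewrite natr_prod big_seq [RHS]big_seq; apply: eq_bigr => i iS.
  by rewrite natrX fsfunE iS.
congr _%:R; apply: eqn_from_log; rewrite ?prod_nth_prime_gt0 // => p.
have [pp|/negbTE np] := boolP (prime p); last by rewrite /logn np.
have [i <-] := nth_prime_surj p pp; rewrite logn_prod_nth_prime ?fset_uniq // SE.
case: ltnP => // ni; apply/esym/eqP; rewrite -leqn0 leqNgt logn_gt0 mem_primes.
apply/negP => /and3P[_ _] /(dvdn_leq n_gt0); rewrite leqNgt.
by rewrite (leq_ltn_trans ni) ?nth_prime_gt.
Qed.

Lemma opp_expseqE (a : expseq) i : opp_expseq a i = - a i.
Proof.
by rewrite fsfunE; case: ifP => // /negbT; rewrite memNfinsupp => /eqP ->; rewrite oppr0.
Qed.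

Lemma finsupp_opp_expseq (a : expseq) : finsupp (opp_expseq a) = finsupp a.
Proof.
by apply/fsetP => i; rewrite !mem_finsupp opp_expseqE oppr_eq0.
Qed.

Lemma prime_pow_opp (a : expseq) : prime_pow (opp_expseq a) = (prime_pow a)^-1.
Proof.
rewrite /prime_pow finsupp_opp_expseq -prodfV.
by apply: eq_bigr => i _; rewrite opp_expseqE invr_expz.
Qed.

(* The junk value of [exponents] is the zero sequence, so no positivity of [q]
   is needed when [a] is nonzero. *)
Lemma exponents_eq (a : expseq) (q : rat) : a != [fsfun] ->
  (exponents q == a) = (q == prime_pow a).
Proof.
move=> a0; rewrite /exponents; apply/eqP/eqP => [|->]; last first.
  by apply: xget_unique => // b /prime_pow_inj.
case: xgetP => [b _ <- <- //|_ a0E]; by rewrite a0E eqxx in a0.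
Qed.


(** * Continuity and measurability on the torus *)

Lemma continuous_prod_topology {T : topologicalType} {I : Type}
    (K : I -> topologicalType) (f : T -> prod_topology K) :
  (forall i, continuous (fun x => f x i)) -> continuous f.
Proof.
(* The product topology is the supremum of the initial topologies of the projections. *)
move=> cf x; apply/cvg_sup => i.
move: x; apply/(@continuousP _ (initial_topology (@^~ i))) => A [B oB <-].
by move/continuousP: (cf i); exact.
Qed.

Section TorusIntegral.
Variable R : realType.
Implicit Types (w z : torus R) (g h : torus R -> R[i]).

Lemma mulc_continuous : continuous (fun x : R[i] * R[i] => x.1 * x.2).
Proof. exact: (@mul_continuous R[i]). Qed.
Lemma addc_continuous : continuous (fun x : R[i] * R[i] => x.1 + x.2).
Proof. exact: (@add_continuous R[i]^o). Qed.
Lemma invc_continuous (x : R[i]) : x != 0 -> {for x, continuous (fun x : R[i] => x^-1)}.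
Proof. exact: (@inv_continuous R[i]). Qed.
Lemma continuous_mulc (T : topologicalType) (f g : T -> R[i]) :
  continuous f -> continuous g -> continuous (fun x => f x * g x).
Proof.
move=> cf cg x; apply: (@continuous2_cvg _ _ _ _ (nbhs x) _ f g (fun a b : R[i] => a * b) (f x) (g x)).
- exact: (mulc_continuous (f x, g x)).
- exact: cf.
- exact: cg.
Qed.
Lemma continuous_addc (T : topologicalType) (f g : T -> R[i]) :
  continuous f -> continuous g -> continuous (fun x => f x + g x).
Proof.
move=> cf cg x; apply: (@continuous2_cvg _ _ _ _ (nbhs x) _ f g (fun a b : R[i] => a + b) (f x) (g x)).
- exact: (addc_continuous (f x, g x)).
- exact: cf.
- exact: cg.
Qed.
Lemma continuous_exprc (T : topologicalType) (f : T -> R[i]) n :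
  continuous f -> continuous (fun x => f x ^+ n).
Proof.
move=> cf; elim: n => [|n IHn]; first exact: cst_continuous.
under eq_fun do rewrite exprS.
exact: continuous_mulc.
Qed.
Lemma continuous_invc (T : topologicalType) (f : T -> R[i]) :
  (forall x, f x != 0) -> continuous f -> continuous (fun x => (f x)^-1).
Proof.
move=> f0 cf x; apply: (@continuous_comp _ _ _ f (fun x : R[i] => x^-1)).
  exact: cf.
exact: invc_continuous.
Qed.

Lemma continuous_circle_val : continuous (val : circle R -> R[i]).
Proof. exact: initial_continuous. Qed.

Lemma continuous_coord i : continuous (fun z : torus R => z i).
Proof. exact: (@proj_continuous _ (fun _ : nat => circle R) i). Qed.

Lemma continuous_val_coord i : continuous (fun z : torus R => val (z i)).
Proof.
move=> z; apply: (@continuous_comp _ _ _ (fun z : torus R => z i) (val : circle R -> R[i])).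
  exact: continuous_coord.
exact: continuous_circle_val.
Qed.

Lemma normr_circle (u : circle R) : `|val u| = 1.
Proof. exact: (set_mem (valP u)). Qed.

Lemma circle_neq0 (u : circle R) : val u != 0.
Proof. by rewrite -normr_gt0 normr_circle. Qed.

Lemma circle_inv_subproof (u : circle R) : (val u)^-1 \in [set z : R[i] | `|z| = 1].
Proof. by apply/mem_set; rewrite /= normfV normr_circle invr1. Qed.

Definition circle_inv (u : circle R) : circle R :=
  exist _ (val u)^-1 (circle_inv_subproof u).

Definition torus_inv w : torus R := fun i => circle_inv (w i).

Lemma torus_mulK w : cancel (torus_mul w) (torus_mul (torus_inv w)).
Proof.
move=> z; apply/funext => i; apply/val_inj => /=.
by rewrite mulrA mulVf ?circle_neq0 // mul1r.
Qed.

Lemma torus_mulKV w : cancel (torus_mul (torus_inv w)) (torus_mul w).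
Proof.
move=> z; apply/funext => i; apply/val_inj => /=.
by rewrite mulrA divff ?circle_neq0 // mul1r.
Qed.

Lemma continuous_torus_mul w : continuous (torus_mul w).
Proof.
apply: continuous_prod_topology => i.
(* The circle carries the topology induced by [val], so its open sets are preimages of open sets [B]
   of [R[i]]. *)
apply/continuousP => _ [B oB <-].
have /continuousP : continuous (fun z : torus R => val (w i) * val (z i)).
  by apply: continuous_mulc; [exact: cst_continuous|exact: continuous_val_coord].
by apply.
Qed.

Lemma measurable_torus_mul w :
  measurable_fun (setT : set (borel_torus R)) (torus_mul w : borel_torus R -> borel_torus R).
Proof.
apply: (@measurability _ _ (borel_torus R) (borel_torus R) _ _ (@open (torus R))) => //.
move=> _ [B oB <-]; rewrite setTI; apply: sub_sigma_algebra.
by have /continuousP := @continuous_torus_mul w; apply.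
Qed.

Lemma continuous_measurable_torus (f : torus R -> R) : continuous f ->
  measurable_fun (setT : set (borel_torus R)) (f : borel_torus R -> R).
Proof.
move=> /continuousP cf; apply: (measurability _ (RGenOpens.measurableE R)).
move=> _ [_ [a [b ->] <-]]; rewrite setTI; apply: sub_sigma_algebra.
exact/cf/interval_open.
Qed.

(** The class of integrands: continuity gives measurability, and the bound gives integrability for a
    probability measure. Carrying the bound along avoids an appeal to compactness. *)
Definition bounded_continuous g :=
  continuous g /\ exists C : R, forall z, `|g z| <= C%:C.

Lemma bounded_continuousD g h : bounded_continuous g -> bounded_continuous h ->
  bounded_continuous (fun z => g z + h z).
Proof.
move=> [cg [C gC]] [ch [D hD]]; split.
  exact: (@continuous_addc (torus R) g h cg ch).
exists (C + D) => z; rewrite rmorphD /=; apply: (le_trans (ler_normD _ _)).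
exact: lerD.
Qed.

Lemma bounded_continuous_translate w g :
  bounded_continuous g -> bounded_continuous (fun z => g (torus_mul w z)).
Proof.
move=> [cg [C gC]]; split; last by exists C => z.
by move=> z; apply: continuous_comp; [exact: continuous_torus_mul|exact: cg].
Qed.

Lemma normc_ge_Im (x : R[i]) : `|complex.Im x|%:C <= `|x|.
Proof.
rewrite normc_def lecR -sqrtr_sqr; apply: ler_wsqrtr.
by rewrite lerDr sqr_ge0.
Qed.

Lemma nbhs_distc_lt (x : R[i]) (e : R) : 0 < e -> nbhs x (fun y => `|x - y| < e%:C).
Proof.
move=> e0; have : (0 : R[i]) < e%:C by rewrite ltcR.
move=> /(@nbhsx_ballx R[i] R[i]^o x); apply: (@filterS _ (nbhs x) (nbhs_filter x)) => y.
by rewrite -ball_normE.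
Qed.

Lemma continuous_Re : continuous (@complex.Re R : R[i] -> R).
Proof.
move=> x; apply/(@cvgrPdist_lt R R^o _ (nbhs x) (nbhs_filter x)) => e e0.
apply: (@filterS _ (nbhs x) (nbhs_filter x) _ _ _ (nbhs_distc_lt x _ e0)) => y /=.
rewrite -raddfB -ltcR; apply: le_lt_trans.
exact: normc_ge_Re.
Qed.

Lemma continuous_Im : continuous (@complex.Im R : R[i] -> R).
Proof.
move=> x; apply/(@cvgrPdist_lt R R^o _ (nbhs x) (nbhs_filter x)) => e e0.
apply: (@filterS _ (nbhs x) (nbhs_filter x) _ _ _ (nbhs_distc_lt x _ e0)) => y /=.
rewrite -raddfB -ltcR; apply: le_lt_trans.
exact: normc_ge_Im.
Qed.

(** * Integration of bounded continuous functions *)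

Variable m : probability (borel_torus R) R.

Lemma bounded_continuous_integrable (f : torus R -> R) :
  continuous f -> (exists C : R, forall z, `|f z| <= C) ->
  m.-integrable setT (EFin \o (f : borel_torus R -> R)).
Proof.
move=> cf [C fC]; apply: measurable_bounded_integrable => //.
- exact: le_lt_trans (probability_le1 m (@measurableT _ _)) (ltry 1).
- exact: continuous_measurable_torus.
- by exists C; split; rewrite ?num_real // => x Cx z _; apply: le_trans (fC z) (ltW Cx).
Qed.

Lemma integrable_Re g : bounded_continuous g ->
  m.-integrable setT (EFin \o ((fun z => complex.Re (g z)) : borel_torus R -> R)).
Proof.
move=> [cg [C gC]]; apply: bounded_continuous_integrable.
  by move=> z; apply: continuous_comp; [exact: cg|exact: continuous_Re].
by exists C => z; rewrite -lecR; apply: le_trans (gC z); exact: normc_ge_Re.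
Qed.

Lemma integrable_Im g : bounded_continuous g ->
  m.-integrable setT (EFin \o ((fun z => complex.Im (g z)) : borel_torus R -> R)).
Proof.
move=> [cg [C gC]]; apply: bounded_continuous_integrable.
  by move=> z; apply: continuous_comp; [exact: cg|exact: continuous_Im].
by exists C => z; rewrite -lecR; apply: le_trans (gC z); exact: normc_ge_Im.
Qed.

Lemma torus_integralD g h : bounded_continuous g -> bounded_continuous h ->
  torus_integral m (fun z => g z + h z) = torus_integral m g + torus_integral m h.
Proof.
move=> bg bh; rewrite /torus_integral.
under eq_Rintegral do rewrite raddfD.
rewrite RintegralD //; [|exact: integrable_Re..].
under [X in _ +i* X]eq_Rintegral do rewrite raddfD.
by rewrite RintegralD //; exact: integrable_Im.
Qed.

Lemma torus_integral_cst (c : R[i]) : torus_integral m (fun=> c) = c.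
Proof.
have RE (r : R) : (\int[m]_(z in setT) r)%R = r.
  rewrite Rintegral_cst //; transitivity (r * 1); last exact: mulr1.
  congr (_ * _); rewrite -[RHS]/(fine 1%E); congr fine.
  exact: (@probability_setT _ _ _ m).
by rewrite /torus_integral !RE; case: c.
Qed.

(** * Translation invariance of the integral *)

Hypothesis m_haar : is_haar m.

(** The change of variables formula reduces this to the equality of [m] with its image under
    translation by [w]. The preimage of [A] under that translation is the image of [A] under
    translation by [torus_inv w], to which [is_haar] applies. *)
Lemma Rintegral_translate w (f : torus R -> R) :
  continuous f -> (exists C : R, forall z, `|f z| <= C) ->
  (\int[m]_(z in setT) f (torus_mul w z))%R = (\int[m]_(z in setT) f z)%R.
Proof.
move=> cf bf; rewrite /Rintegral; congr fine.
have mf := continuous_measurable_torus _ cf.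
transitivity (\int[pushforward m (torus_mul w : borel_torus R -> borel_torus R)]_(z in setT) (f z)%:E)%E.
  rewrite (integral_pushforward (measurable_torus_mul w)) ?preimage_setT //.
    exact/measurable_EFinP.
  apply: (@bounded_continuous_integrable (f \o torus_mul w)).
    by move=> z; apply: continuous_comp; [exact: continuous_torus_mul|exact: cf].
  by case: bf => C fC; exists C => z; exact: fC.
apply: eq_measure_integral => [|mw A mA _]; first exact: measurable_torus_mul.
rewrite [RHS](_ : _ = m (torus_mul (torus_inv w) @` A)); last exact/esym/m_haar.
rewrite /pushforward; congr (m _); apply/seteqP; split => z /=.
  by move=> Awz; exists (torus_mul w z) => //; rewrite torus_mulK.
by case=> y Ay <-; rewrite torus_mulKV.
Qed.

Lemma torus_integral_translate w g : bounded_continuous g ->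
  torus_integral m (fun z => g (torus_mul w z)) = torus_integral m g.
Proof.
move=> [cg [C gC]]; rewrite /torus_integral; congr (_ +i* _).
  apply: (Rintegral_translate w (fun z => complex.Re (g z))).
    by move=> z; apply: continuous_comp; [exact: cg|exact: continuous_Re].
  by exists C => z; rewrite -lecR; apply: le_trans (gC z); exact: normc_ge_Re.
apply: (Rintegral_translate w (fun z => complex.Im (g z))).
  by move=> z; apply: continuous_comp; [exact: cg|exact: continuous_Im].
by exists C => z; rewrite -lecR; apply: le_trans (gC z); exact: normc_ge_Im.
Qed.

(** The function and its translate have the same integral, while their sum vanishes; hence twice the
    integral is zero. *)
Lemma torus_integral_antisymmetric w g : bounded_continuous g ->
  (forall z, g (torus_mul w z) = - g z) -> torus_integral m g = 0.
Proof.
move=> bg gN.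
suff /eqP : torus_integral m g + torus_integral m g = 0.
  by rewrite -mulr2n mulrn_eq0 => /eqP.
rewrite -[X in _ + X](torus_integral_translate w) //.
rewrite -torus_integralD //; last exact: bounded_continuous_translate.
rewrite (_ : (fun z => _) = fun=> 0) ?torus_integral_cst //.
by apply/funext => z; rewrite gN subrr.
Qed.

(** * Orthogonality of the characters *)

(** A monomial over a prescribed index set, with exponents from an arbitrary function: products and
    conjugates then become pointwise operations on the exponents. *)
Definition character (S : {fset nat}) (c : nat -> int) z : R[i] :=
  \prod_(i <- S) val (z i) ^ c i.

Lemma normr_character S c z : `|character S c z| = 1.
Proof.
rewrite /character normr_prod big1 // => i _.
by case: (c i) => k /=; rewrite ?normfV normrX normr_circle expr1n ?invr1.
Qed.

Lemma continuous_character S c : continuous (character S c).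
Proof.
apply: continuous_big => [|i _]; first exact: mulc_continuous.
case: (c i) => k; first exact/continuous_exprc/continuous_val_coord.
apply: continuous_invc; first by move=> z; rewrite expf_neq0 ?circle_neq0.
exact/continuous_exprc/continuous_val_coord.
Qed.

Lemma bounded_continuous_character S c : bounded_continuous (character S c).
Proof.
split; first exact: continuous_character.
by exists 1 => z; rewrite normr_character.
Qed.

(* A translation by such a [u] in one coordinate changes the sign of a
   nontrivial character. *)
Lemma circle_power_eqN1 (k : int) : k != 0 -> exists u : circle R, val u ^ k = -1.
Proof.
move=> k0; have k_gt0 : (0 < `|k|)%N by rewrite absz_gt0.
pose r := `|k|.-root (-1 : R[i]).
have rk : r ^+ `|k| = -1 by rewrite rootCK.
have r1 : `|r| = 1.
  by apply/eqP; rewrite -(@pexpr_eq1 _ _ `|k|) // -normrX rk normrN1.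
exists (exist _ r (mem_set r1)) => /=; clearbody r.
(* For negative [k] the power is the inverse of a power equal to -1, and -1 is its own inverse. *)
by case: k rk {r1 k0 k_gt0} => n /= rn; rewrite ?NegzE -?exprnN -?exprnP rn ?invrN1.
Qed.

(** If all exponents vanish on [S], the character is constantly one. Otherwise, rotating one
    coordinate with nonzero exponent by a suitable [u] changes its sign, so the integral is zero. *)
Lemma torus_integral_character S c :
  torus_integral m (character S c) = (all (fun i => c i == 0) S)%:R.
Proof.
have [/allP c0|/allPn[i iS ci0]] := boolP (all _ _).
  rewrite (_ : character S c = fun=> 1) ?torus_integral_cst //.
  by apply/funext => z; rewrite /character big_seq big1 // => i /c0 /eqP ->.
have [u uN] := circle_power_eqN1 _ ci0.
pose w : torus R := fun j => if j == i then u else circle1 R.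
apply: (torus_integral_antisymmetric w) => [|z]; first exact: bounded_continuous_character.
rewrite /character (big_fsetD1 i iS) [in RHS](big_fsetD1 i iS) /= /w eqxx.
rewrite exprzMl ?unitfE ?circle_neq0 // uN mulN1r mulNr; congr (- (_ * _)).
rewrite big_seq [RHS]big_seq; apply: eq_bigr => j; rewrite !inE => /andP[/negbTE ji _].
by rewrite ji mul1r.
Qed.

End TorusIntegral.


(** * Fourier coefficients of the cosine symbol *)

Section CosineSymbol.
Variable R : realType.
Implicit Types (a e : expseq) (z : torus R) (S : {fset nat}).

Lemma monomial_fset a S z : (finsupp a `<=` S)%fset -> monomial a z = character R S a z.
Proof.
move=> aS; apply: big_fset_incl => // i _; rewrite memNfinsupp => /eqP ->.
by rewrite expr0z.
Qed.

Lemma characterM S c d z :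
  character R S c z * character R S d z = character R S (fun i => c i + d i) z.
Proof.
rewrite /character -big_split; apply: eq_bigr => i _ /=.
by rewrite expfzDr ?circle_neq0.
Qed.

(** A character has modulus one, so its conjugate is its inverse. *)
Lemma conj_character S c z :
  (character R S c z)^*%R = character R S (fun i => - c i) z.
Proof.
apply: (mulfI (x := character R S c z)); first by rewrite -normr_gt0 normr_character.
rewrite -normCK normr_character expr1n characterM /character big1 // => i _.
by rewrite subrr expr0z.
Qed.

Lemma monomial_opp a z : monomial (opp_expseq a) z = (monomial a z)^*%R.
Proof.
rewrite (@monomial_fset a (finsupp a)) // conj_character.
rewrite (@monomial_fset _ (finsupp a)) ?finsupp_opp_expseq //.
by apply: eq_bigr => i _; rewrite opp_expseqE.
Qed.

(** Conjugation exchanges the two summands, so their sum is real. *)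
Lemma real_cosine_symbol a : real_symbol (@cosine_symbol R a).
Proof.
split=> [|z].
  have -> : @cosine_symbol R a = fun z => character R (finsupp a) a z +
      character R (finsupp a) (opp_expseq a) z.
    apply/funext => z; rewrite -!monomial_fset //.
    by rewrite finsupp_opp_expseq.
  by apply: continuous_addc; exact: continuous_character.
rewrite /cosine_symbol monomial_opp; apply/CrealP.
by rewrite rmorphD /= conjCK addrC.
Qed.

(** Both sequences vanish outside the union of their supports. This puts the orthogonality relation
    in terms of equality of exponent sequences. *)
Lemma all_expseq_eq a e :
  all (fun i => a i - e i == 0) (finsupp a `|` finsupp e)%fset = (e == a).
Proof.
apply/allP/eqP => [ae|-> i _]; last by rewrite subrr.
apply/fsfunP => i; have [/ae|] := boolP (i \in finsupp a `|` finsupp e)%fset.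
  by rewrite subr_eq0 => /eqP ->.
by rewrite inE negb_or !memNfinsupp => /andP[/eqP -> /eqP ->].
Qed.

Lemma cosine_symbol_conj_monomial a e : let S := (finsupp a `|` finsupp e)%fset in
  (fun z => @cosine_symbol R a z * (monomial e z)^*%R) =
  (fun z => character R S (fun i => a i - e i) z +
            character R S (fun i => opp_expseq a i - e i) z).
Proof.
move=> S; apply/funext => z; rewrite /cosine_symbol.
rewrite !(@monomial_fset _ S) ?finsupp_opp_expseq ?fsubsetUl ?fsubsetUr //.
by rewrite conj_character mulrDl !characterM.
Qed.

Variable m : probability (borel_torus R) R.
Hypothesis m_haar : is_haar m.

Lemma torus_integral_cosine_symbol a e :
  torus_integral m (fun z => @cosine_symbol R a z * (monomial e z)^*%R) =
  (e == a)%:R + (e == opp_expseq a)%:R.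
Proof.
rewrite cosine_symbol_conj_monomial torus_integralD; try exact: bounded_continuous_character.
rewrite !torus_integral_character // all_expseq_eq -(finsupp_opp_expseq a).
by rewrite all_expseq_eq.
Qed.

Lemma fourier_cosine_symbol a q : a != [fsfun] ->
  fourier m (@cosine_symbol R a) q =
  (q == prime_pow a)%:R + (q == (prime_pow a)^-1)%:R.
Proof.
move=> a0; rewrite /fourier torus_integral_cosine_symbol -prime_pow_opp !exponents_eq //.
(* To use [exponents_eq] at [opp_expseq a], this sequence must be nonzero too. *)
apply: contraNneq a0 => oa; apply/eqP/fsfunP => i; apply: oppr_inj.
by rewrite -opp_expseqE oa !fsfunE oppr0.
Qed.

(** The symbol is real, so its square is its product with its own conjugate. The integral is then
    the sum of the Fourier coefficients at [a] and at its opposite, each equal to one because these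
    two sequences differ. *)
Lemma torus_integral_cosine_symbol_sqr a : a != [fsfun] ->
  torus_integral m (fun z => @cosine_symbol R a z ^+ 2) = 2.
Proof.
move=> a0; have aNa : a != opp_expseq a.
  apply: contraNneq a0 => aE; apply/eqP/fsfunP => i.
  by have := opp_expseqE a i; rewrite -aE fsfunE; lia.
have -> : (fun z => @cosine_symbol R a z ^+ 2) = fun z =>
    @cosine_symbol R a z * (monomial a z)^*%R +
    @cosine_symbol R a z * (monomial (opp_expseq a) z)^*%R.
  apply/funext => z; rewrite -mulrDr -rmorphD /=.
  by have [_ /(_ z)/CrealP ->] := real_cosine_symbol a; rewrite expr2.
rewrite torus_integralD; last 2 first.
- rewrite cosine_symbol_conj_monomial.
  by apply: bounded_continuousD; exact: bounded_continuous_character.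
- rewrite cosine_symbol_conj_monomial.
  by apply: bounded_continuousD; exact: bounded_continuous_character.
rewrite !torus_integral_cosine_symbol !eqxx (negbTE aNa) eq_sym (negbTE aNa).
by rewrite addr0 add0r.
Qed.

(** The zero sequence gives the empty product, which is one. *)
Lemma prime_pow_gt1_neq0 {a n} : (1 < n)%N -> n%:R = prime_pow a -> a != [fsfun].
Proof.
move=> n_gt1; apply: contra_eqN => /eqP ->.
by rewrite /prime_pow finsupp0 big_seq_fset0 (eqr_nat _ n 1) gtn_eqF.
Qed.

(** * Toeplitz entries and the trace as a count *)

Lemma sum_eq_mem (s : {fset nat}) (y : nat) :
  (\sum_(x <- s) (x == y) = (y \in s))%N.
Proof.
have [ys|ys] := boolP (y \in s).
  rewrite (big_fsetD1 y) //= eqxx big1_fset ?addn0 // => x.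
  by rewrite !inE => /andP[/negbTE ->].
by rewrite big1_fset // => x xs _; case: eqP xs ys => // -> ->.
Qed.

Lemma sum_mem_card (s : {fset nat}) (P : pred nat) :
  (\sum_(y <- s) P y = #|` [fset y in s | P y]%fset|)%N.
Proof.
rewrite card_fset_sum1 big_fset /= [RHS]big_mkcond.
by apply: eq_bigr => y _; case: (P y).
Qed.

Lemma sum_nth_fset (A : nmodType) (s : {fset nat}) (G : nat -> A) :
  \sum_(i < #|` s|) G (nth 0%N s i) = \sum_(x <- s) G x.
Proof. by rewrite (big_nth 0%N) big_mkord. Qed.

(** For positive [x] and [y], [x / y = n] means [x = n * y], and [x / y = n^-1] means
    [y = n * x]. *)
Lemma toeplitz_cosine_symbolE a n (s : {fset nat}) i j :
  (1 < n)%N -> n%:R = prime_pow a -> (forall k, k \in s -> (0 < k)%N) ->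
  toeplitz m (@cosine_symbol R a) s i j =
  ((nth 0%N s i == n * nth 0%N s j) + (nth 0%N s j == n * nth 0%N s i))%N%:R.
Proof.
move=> n_gt1 na s_gt0; rewrite mxE (fourier_cosine_symbol _ _ (prime_pow_gt1_neq0 n_gt1 na)).
have gt0 (k : 'I_#|` s|) : (0 < nth 0%N s k)%N by rewrite s_gt0 // mem_nth.
move: (gt0 i) (gt0 j); set x := nth _ _ i; set y := nth _ _ j => x0 y0.
have nz k : (0 < k)%N -> k%:R != 0 :> rat by rewrite pnatr_eq0 lt0n.
rewrite -na natrD; congr (_%:R + _%:R); congr nat_of_bool.
  by rewrite (can2_eq (divfK (nz _ y0)) (mulfK (nz _ y0))) -natrM eqr_nat.
rewrite -[LHS](inj_eq invr_inj) invf_div invrK.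
by rewrite (can2_eq (divfK (nz _ x0)) (mulfK (nz _ x0))) -natrM eqr_nat.
Qed.

(* The products [T i j * T j i] are again [0] or [1], because [x = n y] and
   [y = n x] exclude each other for [n > 1] and positive [x], [y]. *)
Lemma trace_toeplitz_cosine_symbol_sqr a n (s : {fset nat}) :
  (1 < n)%N -> n%:R = prime_pow a -> (forall k, k \in s -> (0 < k)%N) ->
  \tr (toeplitz m (@cosine_symbol R a) s ^+ 2) =
  (2 * #|` [fset k in s | (n * k)%N \in s]%fset|)%N%:R.
Proof.
move=> n_gt1 na s_gt0.
pose F x y := ((x == n * y) + (y == n * x))%N.
transitivity (\sum_(i < #|` s|) \sum_(j < #|` s|)
    (F (nth 0%N s i) (nth 0%N s j))%:R : R[i]).
  rewrite expr2 /mxtrace; apply: eq_bigr => i _; rewrite mxE.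
  apply: eq_bigr => j _; rewrite !(@toeplitz_cosine_symbolE a n) // -natrM; congr _%:R.
  have gt0 (k : 'I_#|` s|) : (0 < nth 0%N s k)%N by rewrite s_gt0 // mem_nth.
  by move: (gt0 i) (gt0 j); rewrite /F; do 2?case: eqP => //; nia.
under eq_bigr => i _.
  rewrite (sum_nth_fset _ _ (fun y => (F (nth 0%N s i) y)%:R)); over.
rewrite (sum_nth_fset _ _ (fun x => \sum_(y <- s) (F x y)%:R)).
under eq_bigr do rewrite -natr_sum.
rewrite -natr_sum; congr _%:R.
under eq_bigr do rewrite big_split /=.
(* Exchanging the sums in one half makes both halves count the elements of [s] whose multiple by [n]
   lies in [s]. *)
rewrite big_split /= mul2n -addnn exchange_big /=.
by congr addn; under eq_bigr do rewrite sum_eq_mem; exact: sum_mem_card.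
Qed.

End CosineSymbol.

(** * From the trace limit to the dilation ratio *)

Theorem proposition3p3 (R : realType)
  (m : probability (borel_torus R) R) (m_haar : is_haar m)
  (sigma : nat -> {fset nat})
  (sigma_pos : forall N k, k \in sigma N -> (0 < k)%N)
  (sigma_neq0 : forall N, sigma N != fset0%fset)
  (n : nat) (n_gt0 : (0 < n)%N)
  (ratio_fails : ~ (dilation_ratio R n (sigma N) @[N --> \oo] --> (1 : R))) :
  (exists phi : torus R -> R[i],
     real_symbol phi /\ ~ square_trace_limit m sigma phi) /\
  (forall a : expseq, n%:R = prime_pow a ->
     real_symbol (@cosine_symbol R a) /\
     ~ square_trace_limit m sigma (@cosine_symbol R a)).
Proof.
(* For [n = 1] the ratio is constantly one, so its convergence could not fail. *)
have n_gt1 : (1 < n)%N.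
  rewrite ltn_neqAle n_gt0 andbT; apply/eqP => n1; apply: ratio_fails.
  rewrite (_ : (fun N => _) = fun=> 1); first exact: cvg_cst.
  apply/funext => N; rewrite /dilation_ratio -n1.
  rewrite (_ : [fset _ in _ | _]%fset = sigma N) ?divff ?pnatr_eq0 ?cardfs_eq0 //.
  by apply/fsetP => k; rewrite !inE mul1n andbb.
(* The existential part follows, since [prime_pow_nat] provides an exponent sequence for [n]. *)
suff main a : n%:R = prime_pow a -> real_symbol (@cosine_symbol R a) /\
     ~ square_trace_limit m sigma (@cosine_symbol R a).
  split=> //; have [a an] := prime_pow_nat n n_gt0.
  by exists (@cosine_symbol R a); exact: main.
move=> na; split; first exact: real_cosine_symbol.
have a0 := prime_pow_gt1_neq0 n_gt1 na.
rewrite /square_trace_limit torus_integral_cosine_symbol_sqr // => lim2.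
apply: ratio_fails.
(* The ratio is real and the traces are complex, so it is recovered as half the real part of the
   normalised trace. *)
have -> : (fun N => dilation_ratio R n (sigma N)) = fun N => 2^-1 *
    complex.Re (#|` sigma N|%:R^-1 * \tr (toeplitz m (@cosine_symbol R a) (sigma N) ^+ 2)).
  apply/funext => N; rewrite (@trace_toeplitz_cosine_symbol_sqr _ _ m_haar _ n) //; last exact: sigma_pos.
  have ReE (x : R) : complex.Re (real_complex R x) = x by [].
  rewrite -!(rmorph_nat (real_complex R)) -fmorphV -rmorphM ReE natrM.
  by rewrite mulrCA mulKf ?pnatr_eq0 // mulrC.
(* The target 1 is written as half of 2, where 2 is the real part of the assumed limit; continuity
   of [complex.Re] concludes. *)
rewrite -[X in _ --> X](@mulVf R 2) ?pnatr_eq0 //.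
apply: cvgM; first exact: cvg_cst.
have -> : (2 : R) = complex.Re (2 : R[i]) by rewrite -(rmorph_nat (real_complex R)).
exact: (cvg_comp _ _ lim2 (@continuous_Re R _)).
Qed.
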